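(* Consider the waiting-time chain $X_0=0$, $X_{i+1}=\max(0,X_i+U_i)$, $i\ge0$, of a $GI/G/1$ queue, let $z\in\mathbb R$ and $f(u)=\mathbf 1\{u>z\}$ for $u\in\mathbb R$. If $E(U_i)<0$ and $E(U_i^6)$ is finite, then there is a constant $c>0$ such that $$E\big((f(X_{i,m})-f(X_i))^2\big)\le c\,(i+1)^{-2}\quad\text{for all integers } i,m\ge0,$$ and the positive decreasing sequence $\nu(i)=c(i+1)^{-2}$ satisfies $\sum_{i=0}^\infty\sqrt{\nu(i)/(i+1)}<\infty$.
   Context: In the $GI/G/1$ queue, $U_i=V_i-D_i$ where $V_i$ is the service time of customer $i$ and $D_i$ the interarrival time between customers $i$ and $i+1$; the pairs $(D_n,V_n)$ are identically distributed and all the variables $D_n,V_n$ are independent, so the $U_i$ are i.i.d. real random variables. The sequence is extended to i.i.d. random variables $(U_i)_{i\in\mathbb Z}$. For an integer $m\ge0$, $(X_{i,m})_{i\ge-m}$ is defined by $X_{-m,m}=0$ and $X_{i+1,m}=\max(0,X_{i,m}+U_i)$ for $i\ge-m$ (same $U_i$). *)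

(* Defs.v *)
From HB Require Import structures.
From mathcomp Require Import all_boot all_order all_algebra.
From mathcomp Require Import all_classical all_reals all_analysis.

Set Implicit Arguments.
Unset Strict Implicit.
Unset Printing Implicit Defensive.

Import Order.TTheory GRing.Theory Num.Theory.
Import numFieldNormedType.Exports.

Local Open Scope classical_set_scope.
Local Open Scope ring_scope.

(* Mutual independence: the product rule over every finite subfamily. *)
Definition mutually_independent (d d' : measure_display)
    (T : measurableType d) (T' : measurableType d') (R : realType)
    (P : probability T R) (I : eqType) (X : I -> T -> T') : Prop :=
  forall (J : seq I) (B : I -> set T'),
    uniq J -> (forall i, measurable (B i)) ->
    P (\big[setI/setT]_(i <- J) (X i @^-1` B i)) =
    (\prod_(i <- J) P (X i @^-1` B i))%E.

Definition identically_distributed (d d' : measure_display)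
    (T : measurableType d) (T' : measurableType d') (R : realType)
    (P : probability T R) (I : Type) (X : I -> T -> T') : Prop :=
  forall (i j : I) (B : set T'), measurable B ->
    pushforward P (X i) B = pushforward P (X j) B.

(* The inputs of a GI/G/1 queue: [D n] is the time between the arrivals of
   customers n and n+1, and [V n] the service time of customer n.  The index
   type [nat + nat] merges the two sequences into a single family.  The signs
   of D and V play no role and are left unconstrained. *)
Definition GI_G_1 (d : measure_display) (T : measurableType d) (R : realType)
    (P : probability T R) (D V : nat -> {RV P >-> R}) : Prop :=
  identically_distributed P (fun (n : nat) (t : T) => (D n t, V n t)) /\
  mutually_independent P (fun k : nat + nat =>
    match k with inl n => D n : T -> R | inr n => V n : T -> R end).

Definition iid (d : measure_display) (T : measurableType d) (R : realType)
    (P : probability T R) (I : eqType) (U : I -> {RV P >-> R}) : Prop :=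
  identically_distributed P (fun i => U i : T -> R) /\
  mutually_independent P (fun i => U i : T -> R).

Fixpoint waiting (R : realType) (T : Type) (U : int -> T -> R) (i : nat)
    (t : T) : R :=
  if i is j.+1 then Num.max 0 (waiting U j t + U j%:Z t) else 0.

(* The chain started from 0 at time -m, after k steps: X_{k-m,m}. *)
Fixpoint waiting_steps (R : realType) (T : Type) (U : int -> T -> R)
    (m k : nat) (t : T) : R :=
  if k is j.+1
  then Num.max 0 (waiting_steps U m j t + U (j%:Z - m%:Z) t) else 0.

(* X_{i,m} for i >= 0, reached from time -m after i + m steps. *)
Definition waiting_from (R : realType) (T : Type) (U : int -> T -> R)
    (m i : nat) : T -> R := waiting_steps U m (i + m).

(* Main.v *)
(* X_{i,m} and X_i move together once they meet, and they can differ at time i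
   only if the chain started at -m has not been reset to 0 after time 0; then
   X_{i,m} is a sum U_{i-1} + ... + U_{-k} > 0 of n = i + k increments, for some
   k <= m.  Such a sum exceeds its mean by at least n |E U|, so by Markov's
   inequality for sixth moments this has probability O(n^3 / n^6) = O(n^-3),
   and summing over k >= 0 gives O(i^-2).  The bound E(S_n^6) = O(n^3) for
   centered sums comes from expanding E((S_n + Y_n)^6), where S_n and Y_n are
   independent and the terms with a factor E(Y_n) vanish. *)

Require Import Defs.
From HB Require Import structures.
From mathcomp Require Import all_boot all_order all_algebra.
From mathcomp Require Import all_classical all_reals all_analysis.
From mathcomp Require Import measurable_realfun.
From mathcomp Require Import ring lra zify.

Set Implicit Arguments.
Unset Strict Implicit.
Unset Printing Implicit Defensive.

Import Order.TTheory GRing.Theory Num.Theory.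
Import numFieldNormedType.Exports.

Local Open Scope classical_set_scope.
Local Open Scope ring_scope.

(** * Independence and expectation of products *)

Section indep.
Context d (T : measurableType d) (R : realType) (P : probability T R).
Implicit Types X Y S : {mfun T >-> R}.

Definition pair_mfun X Y (t : T) : R * R := (X t, Y t).

Lemma measurable_pair_mfun X Y : measurable_fun setT (pair_mfun X Y).
Proof. exact: measurable_fun_pair. Qed.

HB.instance Definition _ X Y := isMeasurableFun.Build _ _ _ _
  (pair_mfun X Y) (measurable_pair_mfun X Y).

Definition independent_pair X Y := forall A B : set R,
  measurable A -> measurable B ->
  P (X @^-1` A `&` Y @^-1` B) = (P (X @^-1` A) * P (Y @^-1` B))%E.

(** Independence is agreement on measurable rectangles, which determines the product measure. This
    is what makes Fubini and Tonelli available for products of independent variables. *)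
Lemma independent_pair_law X Y : independent_pair X Y ->
  forall Z, measurable Z ->
  P (pair_mfun X Y @^-1` Z) = (distribution P X \x distribution P Y)%E Z.
Proof.
move=> XY Z mZ.
by rewrite (product_measure_unique (m' := distribution P (pair_mfun X Y))).
Qed.

Lemma measurable_preimage_mfun X (A : set R) :
  measurable A -> measurable (X @^-1` A).
Proof. by move=> mA; rewrite -[_ @^-1` _]setTI; exact: measurable_funPT. Qed.

(* W stands for an event about the future increments: carrying it along is what
   allows the independence of S_n and Y_n to be proved by induction on n. *)
Lemma independent_pair_event X Y (W : set T) : measurable W ->
  (forall A B : set R, measurable A -> measurable B ->
    P (X @^-1` A `&` Y @^-1` B `&` W) =
    (P (X @^-1` A `&` Y @^-1` B) * P W)%E) ->
  forall Z, measurable Z ->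
  P (pair_mfun X Y @^-1` Z `&` W) = (P (pair_mfun X Y @^-1` Z) * P W)%E.
Proof.
move=> mW XYW Z mZ.
have w0 : (0 <= fine (P W))%R by rewrite fine_ge0.
have PW : (fine (P W))%:E = P W by rewrite fineK// fin_num_measure.
pose m1 : {measure set (R * R) -> \bar R} :=
  pushforward (mrestr P mW) (pair_mfun X Y).
pose m2 : {measure set (R * R) -> \bar R} :=
  mscale (NngNum w0) (distribution P (pair_mfun X Y)).
have -> : (P (pair_mfun X Y @^-1` Z) * P W)%E = m2 Z.
  by rewrite /m2/= /mscale/= PW muleC.
pose C : set (set (R * R)) := [set A `*` B | A in measurable & B in measurable].
rewrite -[LHS]/(m1 (measurable_pair_mfun X Y) Z).
apply: (measure_unique C (fun=> setT)) => //.
- by rewrite measurable_prod_measurableType.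
- move=> _ _ [A1 mA1 [B1 mB1 <-]] [A2 mA2 [B2 mB2 <-]]; rewrite -setXI.
  exists (A1 `&` A2); first exact: measurableI.
  by exists (B1 `&` B2) => //; exact: measurableI.
- by move=> _; exists setT => //; exists setT => //; rewrite setXTT.
- by rewrite bigcup_const.
- move=> _ [A mA [B mB <-]].
  rewrite /m1 /m2 /= /mscale /= PW.
  by rewrite -[LHS]/(P (X @^-1` A `&` Y @^-1` B `&` W)) XYW// muleC.
- move=> _; rewrite -[ltLHS]/(P (setT `&` W)) setTI.
  by rewrite (le_lt_trans (probability_le1 P mW))// ltry.
Qed.

(** Transported to the product law, Tonelli gives E|XY| = E|X| E|Y|, which is finite. *)
Lemma independent_integrable_mul X Y : independent_pair X Y ->
  P.-integrable setT (EFin \o X) -> P.-integrable setT (EFin \o Y) ->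
  P.-integrable setT (EFin \o (fun t => X t * Y t)).
Proof.
move=> XY iX iY; apply/integrableP; split.
  by apply/measurable_EFinP; exact: measurable_funM.
have mxy : measurable_fun setT (fun z : R * R => (`|z.1| * `|z.2|)%:E).
  by apply/measurable_EFinP; apply: measurable_funM; apply: measurableT_comp.
have -> : (\int[P]_t `|(EFin \o (fun t => X t * Y t)%R) t| =
  \int[distribution P (pair_mfun X Y)]_z (`|z.1| * `|z.2|)%:E)%E.
  rewrite ge0_integral_distribution//.
  by apply: eq_integral => t _; rewrite /= normrM.
rewrite (eq_measure_integral (distribution P X \x distribution P Y)%E);
  last first.
  by move=> A mA _; exact: independent_pair_law.
rewrite fubini_tonelli1//=.
have mabs : measurable_fun setT (fun y : R => `|y|%:E).
  by apply/measurable_EFinP.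
have Y0 : (0 <= \int[P]_t `|(EFin \o Y) t|)%E by exact: integral_ge0.
have EY (x : R) : (\int[distribution P Y]_y (`|x| * `|y|)%:E =
    `|x|%:E * \int[P]_t `|(EFin \o Y) t|)%E.
  under eq_integral do rewrite EFinM.
  by rewrite ge0_integralZl// ge0_integral_distribution.
rewrite /fubini_F/=; under eq_integral do rewrite EY.
rewrite ge0_integralZr// ge0_integral_distribution//.
have /integrableP[_ {}iX] := iX; have /integrableP[_ {}iY] := iY.
by rewrite lte_mul_pinfty// ?ge0_fin_numE//; apply: integral_ge0 => t _;
  rewrite lee_fin.
Qed.

Lemma independent_expectation_mul X Y : independent_pair X Y ->
  P.-integrable setT (EFin \o X) -> P.-integrable setT (EFin \o Y) ->
  (\int[P]_t (X t * Y t) = \int[P]_t X t * \int[P]_t Y t)%R.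
Proof.
move=> XY iX iY; have iXY := independent_integrable_mul XY iX iY.
have mxy : measurable_fun setT (fun z : R * R => (z.1 * z.2)%:E).
  by apply/measurable_EFinP; exact: measurable_funM.
have mE : measurable_fun setT (EFin : R -> \bar R) by exact/measurable_EFinP.
have dY : (distribution P Y).-integrable setT (EFin : R -> \bar R).
  exact: integrable_pushforward.
have dX : (distribution P X).-integrable setT (EFin : R -> \bar R).
  exact: integrable_pushforward.
have EPX : (\int[P]_t (X t)%:E)%E \is a fin_num by exact: integrable_fin_num.
have EPY : (\int[P]_t (Y t)%:E)%E \is a fin_num by exact: integrable_fin_num.
have law A : measurable A -> A `<=` setT -> distribution P (pair_mfun X Y) A =
    (distribution P X \x distribution P Y)%E A.
  by move=> mA _; exact: independent_pair_law.
have dXY : (distribution P X \x distribution P Y)%E.-integrable setT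
    (fun z : R * R => (z.1 * z.2)%:E).
  apply/integrableP; split => //.
  rewrite -(eq_measure_integral _ law).
  have /integrableP[_] : (distribution P (pair_mfun X Y)).-integrable setT
    (fun z : R * R => (z.1 * z.2)%:E) by exact: integrable_pushforward.
  by [].
rewrite /Rintegral -fineM//; congr fine.
rewrite -(integral_distribution (X := pair_mfun X Y) mxy iXY).
rewrite (eq_measure_integral _ law) -integral12_prod_meas1//.
have EY (x : R) : (\int[distribution P Y]_y (x * y)%:E =
    x%:E * \int[P]_t (Y t)%:E)%E.
  under eq_integral do rewrite EFinM.
  by rewrite integralZl// integral_distribution.
rewrite /fubini_F/=; under eq_integral do rewrite EY.
rewrite -(fineK EPY) integralZr//.
by rewrite integral_distribution.
Qed.

End indep.

(** * Moments of partial sums *)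

Section sums.
Context d (T : measurableType d) (R : realType) (P : probability T R).
Implicit Types (X : {mfun T >-> R}) (Y : nat -> {mfun T >-> R}).

Lemma measurable_big_preimage Y (J : seq nat) (B : nat -> set R) :
  (forall j, measurable (B j)) ->
  measurable (\big[setI/setT]_(j <- J) (Y j @^-1` B j)).
Proof.
by move=> mB; apply: bigsetI_measurable => j _; exact: measurable_preimage_mfun.
Qed.

(** Induction on n for all families J of later indices at once: in the step, the event on [Y n]
    joins J, so the hypothesis applies to [n :: J]. Hence the pair (S_n, Y_n) is independent of W on
    rectangles, thus on all measurable sets of the plane, in particular on those of the form x + y
    in E. *)
Lemma partial_sum_independent Y n (J : seq nat) (B : nat -> set R) (E : set R) :
  mutually_independent P (fun l => Y l : T -> R) ->
  uniq J -> all (leq n) J -> (forall j, measurable (B j)) -> measurable E ->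
  P ((\sum_(l < n) Y l)%R @^-1` E `&`
     \big[setI/setT]_(j <- J) (Y j @^-1` B j)) =
  (P ((\sum_(l < n) Y l)%R @^-1` E) *
   P (\big[setI/setT]_(j <- J) (Y j @^-1` B j)))%E.
Proof.
move=> iY; elim: n J B E => [|n IH] J B E uJ nJ mB mE.
  rewrite big_ord0; have [E0|E0] := pselect (E 0).
    have -> : (0 : {mfun T >-> R}) @^-1` E = setT by apply/seteqP; split.
    by rewrite setTI probability_setT mul1e.
  have -> : (0 : {mfun T >-> R}) @^-1` E = set0 by apply/seteqP; split.
  by rewrite set0I measure0 mul0e.
set W := \big[setI/setT]_(j <- J) _.
have mW : measurable W by exact: measurable_big_preimage.
set S := \sum_(l < n) Y l.
have nnJ : n \notin J by apply/negP => /(allP nJ); rewrite /= ltnn.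
have lJ : all (leq n) J by apply: sub_all nJ => j /ltnW.
(* As n is not in J, the family B can be overridden at n without changing W. *)
have pB (B' : set R) : Y n @^-1` B' `&` W =
    \big[setI/setT]_(j <- n :: J) (Y j @^-1` (if j == n then B' else B j)).
  rewrite big_cons eqxx; congr (_ `&` _).
  rewrite /W !big_seq; apply: eq_bigr => j jJ; case: eqP => // jn.
  by rewrite -jn jJ in nnJ.
have mB' (B' : set R) : measurable B' ->
    forall j, measurable (if j == n then B' else B j).
  by move=> mB' j; case: ifP.
have SY (A B' : set R) : measurable A -> measurable B' ->
    P (S @^-1` A `&` Y n @^-1` B') = (P (S @^-1` A) * P (Y n @^-1` B'))%E.
  move=> mA mB0; have := IH [:: n] (fun=> B') A isT.
  by rewrite /= leqnn big_seq1; apply.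
have SYW (A B' : set R) : measurable A -> measurable B' ->
    P (S @^-1` A `&` Y n @^-1` B' `&` W) =
    (P (S @^-1` A `&` Y n @^-1` B') * P W)%E.
  move=> mA mB0; rewrite -setIA pB IH//=; last 3 first.
  - by rewrite nnJ.
  - by rewrite leqnn.
  - exact: mB'.
  rewrite SY// -muleA; congr (_ * _)%E.
  rewrite iY/=; [|by rewrite nnJ|exact: mB'].
  rewrite big_cons eqxx /W iY//; congr (_ * _)%E.
  rewrite !big_seq; apply: eq_bigr => j jJ; case: eqP => // jn.
  by rewrite -jn jJ in nnJ.
have madd : measurable_fun setT (fun z : R * R => z.1 + z.2).
  exact: measurable_funD.
have mZ : measurable ((fun z : R * R => z.1 + z.2) @^-1` E).
  by rewrite -[_ @^-1` _]setTI; exact: madd.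
have := independent_pair_event mW SYW mZ.
by rewrite big_ord_recr.
Qed.

Lemma partial_sum_independent_next Y n :
  mutually_independent P (fun l => Y l : T -> R) ->
  independent_pair P (\sum_(l < n) Y l) (Y n).
Proof.
move=> iY A B mA mB.
have := @partial_sum_independent Y n [:: n] (fun=> B) A iY isT.
by rewrite /= leqnn big_seq1; apply.
Qed.

Definition mean X : R := \int[P]_t X t.

Definition sintegrable X := P.-integrable setT (EFin \o X).

Lemma sintegrableM X Z : independent_pair P X Z ->
  sintegrable X -> sintegrable Z -> sintegrable (X * Z).
Proof. exact: independent_integrable_mul. Qed.

Lemma meanM X Z : independent_pair P X Z ->
  sintegrable X -> sintegrable Z -> mean (X * Z) = mean X * mean Z.
Proof. exact: independent_expectation_mul. Qed.

Lemma sintegrableD X Z : sintegrable X -> sintegrable Z -> sintegrable (X + Z).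
Proof. exact: integrableD. Qed.

Lemma meanD X Z : sintegrable X -> sintegrable Z ->
  mean (X + Z) = mean X + mean Z.
Proof. exact: RintegralD. Qed.

Lemma sintegrable1 : sintegrable 1.
Proof. exact: finite_measure_integrable_cst. Qed.

Lemma sintegrable0 : sintegrable 0.
Proof. exact: finite_measure_integrable_cst. Qed.

Lemma mean1 : mean 1 = 1.
Proof.
have -> : mean 1 = \int[P]_(t in setT) 1 by [].
rewrite Rintegral_cst// mul1r.
exact: (congr1 fine (probability_setT P)).
Qed.

Lemma mean0 : mean 0 = 0.
Proof. by rewrite /mean Rintegral_cst// mul0r. Qed.

Lemma mean_sum (I : Type) (r : seq I) (F : I -> {mfun T >-> R}) :
  (forall i, sintegrable (F i)) ->
  sintegrable (\sum_(i <- r) F i) /\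
  mean (\sum_(i <- r) F i) = \sum_(i <- r) mean (F i).
Proof.
move=> iF; elim: r => [|i r [IH1 IH2]].
  by rewrite !big_nil mean0; split => //; exact: sintegrable0.
by rewrite !big_cons meanD// IH2; split => //; exact: sintegrableD.
Qed.

Lemma mean_natmul X n : sintegrable X ->
  sintegrable (X *+ n) /\ mean (X *+ n) = mean X *+ n.
Proof.
move=> iX; elim: n => [|n [IH1 IH2]].
  by rewrite !mulr0n mean0; split => //; exact: sintegrable0.
by rewrite !mulrS meanD// IH2; split => //; exact: sintegrableD.
Qed.

Lemma independent_pairX X Z a b : independent_pair P X Z ->
  independent_pair P (X ^+ a) (Z ^+ b).
Proof.
move=> XZ A B mA mB.
have mpow k (C : set R) : measurable C ->
    measurable ((fun x : R => x ^+ k) @^-1` C).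
  move=> mC; rewrite -[_ @^-1` _]setTI.
  by apply: (measurable_funX k (@measurable_id _ _ setT)).
by rewrite !mfunX; exact: (XZ _ _ (mpow a _ mA) (mpow b _ mB)).
Qed.

Lemma meanXD X Z k : independent_pair P X Z ->
  (forall a, (a <= k)%N -> sintegrable (X ^+ a)) ->
  (forall a, (a <= k)%N -> sintegrable (Z ^+ a)) ->
  sintegrable ((X + Z) ^+ k) /\
  mean ((X + Z) ^+ k) =
    \sum_(i < k.+1) (mean (X ^+ (k - i)) * mean (Z ^+ i)) *+ 'C(k, i).
Proof.
move=> XZ iX iZ; rewrite exprDn.
have iM (i : 'I_k.+1) : sintegrable (X ^+ (k - i) * Z ^+ i).
  apply: sintegrableM; first exact: independent_pairX.
  - by apply: iX; exact: leq_subr.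
  - by apply: iZ; rewrite -ltnS.
have [|-> ->] := @mean_sum _ (index_enum 'I_k.+1)
    (fun i : 'I_k.+1 => X ^+ (k - i) * Z ^+ i *+ 'C(k, i)).
  by move=> i; have [] := mean_natmul 'C(k, i) (iM i).
split => //; apply: eq_bigr => i _.
have [_ ->] := mean_natmul 'C(k, i) (iM i); rewrite meanM//.
- exact: independent_pairX.
- by apply: iX; exact: leq_subr.
- by apply: iZ; rewrite -ltnS.
Qed.

End sums.

(** The sum of the coefficients of E(S_{n+1}^6) - E(S_n^6) once n and n(n-1) are bounded by n^2, for
    n >= 1. The increment is then at most K n^2 <= K ((n+1)^3 - n^3). *)
Definition sixth_moment_const (R : pzRingType) (A : nat -> R) : R :=
  A 6%N + 15 * A 2%N * (A 4%N + 3 * A 2%N ^+ 2) + 20 * A 3%N ^+ 2 +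
     15 * A 2%N * A 4%N.

Lemma sixth_moment_step (R : realFieldType) (a2 a3 a4 a6 x m : R)
    (K := a6 + 15 * a2 * (a4 + 3 * a2 ^+ 2) + 20 * a3 ^+ 2 + 15 * a2 * a4) :
  0 <= a2 * a4 -> 0 <= a2 ^+ 3 -> 0 <= a3 ^+ 2 -> 0 <= a6 -> 0 <= x ->
  m <= K * x ^+ 3 ->
  m + 15 * (x * a4 + 3 * x * (x - 1) * a2 ^+ 2) * a2 + 20 * (x * a3) * a3 +
    15 * (x * a2) * a4 + a6 <= K * (x + 1) ^+ 3.
Proof.
move=> K1 K2 K3 K4 x0; rewrite -subr_ge0 => mK; rewrite -subr_ge0.
have x2 : 0 <= x ^+ 2 by exact: sqr_ge0.
(* The difference is the slack in the hypothesis plus nonnegative moment products, each times a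
   polynomial in x with nonnegative coefficients. The sign of a3 is unknown, but only its square
   occurs. *)
have -> : K * (x + 1) ^+ 3 - (m + 15 * (x * a4 + 3 * x * (x - 1) * a2 ^+ 2) * a2
    + 20 * (x * a3) * a3 + 15 * (x * a2) * a4 + a6) =
  (K * x ^+ 3 - m) + a6 * (3 * x ^+ 2 + 3 * x) +
  (a2 * a4) * (15 * (6 * x ^+ 2 + 4 * x + 2)) +
  (a2 ^+ 3) * (45 * (2 * x ^+ 2 + 4 * x + 1)) +
  (a3 ^+ 2) * (20 * (3 * x ^+ 2 + 2 * x + 1)) by rewrite /K; ring.
by do 4 (apply: addr_ge0; last by apply: mulr_ge0 => //; clear -x0 x2; lra).
Qed.

(* Here A k = E(Y^k) and m n k = E(S_n^k), with E(Y) = 0. *)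
Lemma sixth_moment_growth (R : realFieldType) (m : nat -> nat -> R)
    (A : nat -> R) :
  A 0%N = 1 -> A 1%N = 0 -> 0 <= A 2%N -> 0 <= A 4%N -> 0 <= A 6%N ->
  (forall n, m n 0%N = 1) -> (forall k, m 0%N k.+1 = 0) ->
  (forall n k, (k <= 6)%N -> m n.+1 k =
     \sum_(i < k.+1) (m n (k - i)%N * A i) *+ 'C(k, i)) ->
  forall n, m n 6%N <= sixth_moment_const A * n%:R ^+ 3.
Proof.
move=> A0 A1 A2 A4 A6 m0 mS rec n; rewrite /sixth_moment_const.
have m1 k : m k 1%N = 0.
  elim: k => [|k IH]; first exact: mS.
  by rewrite rec// !big_ord_recr big_ord0 /= !binS !bin0 m0 IH A0 A1 /=; ring.
have m2 k : m k 2%N = k%:R * A 2%N.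
  elim: k => [|k IH]; first by rewrite mS mul0r.
  rewrite rec// !big_ord_recr big_ord0 /= /bump /= m0 m1 IH A0 A1 -natr1.
  by rewrite /= /binomial /=; ring.
have m3 k : m k 3%N = k%:R * A 3%N.
  elim: k => [|k IH]; first by rewrite mS mul0r.
  rewrite rec// !big_ord_recr big_ord0 /= !subSS !subn0.
  rewrite m0 m1 m2 IH A0 A1 -natr1.
  by rewrite /= /binomial /=; ring.
have m4 k : m k 4%N = k%:R * A 4%N + 3 * k%:R * (k%:R - 1) * A 2%N ^+ 2.
  elim: k => [|k IH]; first by rewrite mS; ring.
  rewrite rec// !big_ord_recr big_ord0 /= !subSS !subn0.
  rewrite m0 m1 m2 m3 IH A0 A1 -natr1.
  by rewrite /= /binomial /=; ring.
(* The splits 5+1 and 1+5 of the exponent drop out because both first moments vanish. *)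
have m6 k : m k.+1 6%N = m k 6%N + 15 * m k 4%N * A 2%N + 20 * m k 3%N * A 3%N
    + 15 * m k 2%N * A 4%N + A 6%N.
  rewrite rec// !big_ord_recr big_ord0 /= !subSS !subn0 m0 m1 A0 A1.
  by rewrite /= /binomial /=; ring.
have K1 : 0 <= A 2%N * A 4%N by exact: mulr_ge0.
have K2 : 0 <= A 2%N ^+ 3 by exact: exprn_ge0.
have K3 : 0 <= A 3%N ^+ 2 by exact: sqr_ge0.
elim: n => [|n IH]; first by rewrite mS expr0n mulr0.
have x0 : 0 <= n%:R :> R by exact: ler0n.
rewrite m6 m4 m3 m2 -(natr1 n).
move: (A 2%N) (A 3%N) (A 4%N) (A 6%N) (m n 6%N) n%:R K1 K2 K3 A6 x0 IH.
move=> a2 a3 a4 a6 m' x K1 K2 K3 a6_ge0 x0 IH.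
exact: sixth_moment_step.
Qed.

(** * Numerical series *)

(* Telescoping with n^(-3/2) <= 2 ((n-1)^(-1/2) - n^(-1/2)). *)
Lemma sum_sqrt_inv_cube_le (R : rcfType) (n : nat) :
  \sum_(0 <= i < n.+1) Num.sqrt (i.+1%:R^-1 : R) ^+ 3 <=
  3 - 2 * Num.sqrt (n.+1%:R^-1).
Proof.
elim: n => [|n IH]; first by rewrite big_nat1 invr1 sqrtr1 expr1n; lra.
rewrite big_nat_recr//=; apply: le_trans (lerD IH (lexx _)) _.
set p := Num.sqrt _; set q := Num.sqrt _.
have p0 : 0 < p by rewrite sqrtr_gt0 invr_gt0.
have q0 : 0 < q by rewrite sqrtr_gt0 invr_gt0.
have pq : q <= p by rewrite ler_wsqrtr// lef_pV2 ?posrE// ler_nat.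
(* This is 1/(n+1) - 1/(n+2) = 1/((n+1)(n+2)). After multiplication by p + q, the telescoping
   inequality reduces to q p + q^2 <= 2 p^2, that is, to q <= p. *)
have E : (p - q) * (p + q) = p ^+ 2 * q ^+ 2.
  rewrite -subr_sqr !sqr_sqrtr ?invr_ge0// -!natr1.
  have : 0 <= n%:R :> R by [].
  by move=> ?; field; rewrite !lt0r_neq0//; lra.
suff : q ^+ 3 <= 2 * (p - q) by lra.
have pq0 : 0 < p + q by lra.
rewrite -(ler_pM2r pq0) -[leRHS]mulrA E.
have -> : q ^+ 3 * (p + q) = q ^+ 2 * (q * p + q * q) by ring.
have -> : 2 * (p ^+ 2 * q ^+ 2) = q ^+ 2 * (2 * (p * p)) by ring.
rewrite ler_wpM2l ?sqr_ge0//; nra.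
Qed.

(* Telescoping with n^-3 <= 8 (n^-2 - (n+1)^-2). *)
Lemma sum_inv_cube_le (R : realFieldType) (i m : nat) : (0 < i)%N ->
  \sum_(k < m) ((i + k)%:R ^- 3 : R) <= 32 * i.+1%:R ^- 2.
Proof.
move=> i0.
have H : \sum_(k < m) ((i + k)%:R ^- 3 : R) <=
    8 * (i%:R ^- 2 - (i + m)%:R ^- 2).
  elim: m => [|m IH]; first by rewrite big_ord0 addn0 subrr mulr0.
  rewrite big_ord_recr/= addnS; apply: le_trans (lerD IH (lexx _)) _.
  set n := (i + m)%N.
  suff : (n%:R ^- 3 : R) <= 8 * (n%:R ^- 2 - n.+1%:R ^- 2).
    by move: (i%:R ^- 2) (n%:R ^- 2) (n%:R ^- 3) (n.+1%:R ^- 2) => a b c e; lra.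
  have x1 : 1 <= n%:R :> R by rewrite ler1n /n; lia.
  rewrite -(natr1 n); move: x1; set x : R := n%:R => x1.
  rewrite -subr_ge0.
  have -> : 8 * (x ^- 2 - (x + 1) ^- 2) - x ^- 3 =
    (8 * x * (2 * x + 1) - (x + 1) ^+ 2) / (x ^+ 3 * (x + 1) ^+ 2).
    by field; rewrite !lt0r_neq0//; lra.
  by rewrite divr_ge0//; [nra|rewrite mulr_ge0 ?exprn_ge0//; lra].
apply: le_trans H _.
have x1 : 1 <= i%:R :> R by rewrite ler1n.
have y0 : 0 <= (i + m)%:R ^- 2 :> R by rewrite invr_ge0 exprn_ge0.
(* Since i + 1 <= 2 i, passing from i to i + 1 costs a factor 4, which turns 8 into 32. *)
suff : (i%:R ^- 2 : R) <= 4 * i.+1%:R ^- 2.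
  by move: y0; move: (i%:R ^- 2) ((i + m)%:R ^- 2) (i.+1%:R ^- 2) => a b c; lra.
rewrite -(natr1 i); move: x1; set x : R := i%:R => x1.
rewrite -subr_ge0.
have -> : 4 * (x + 1) ^- 2 - x ^- 2 =
  (4 * x ^+ 2 - (x + 1) ^+ 2) / (x ^+ 2 * (x + 1) ^+ 2).
  by field; rewrite !lt0r_neq0//; lra.
by rewrite divr_ge0//; [nra|rewrite mulr_ge0 ?exprn_ge0//; lra].
Qed.

(** * Sample paths of the waiting-time chains *)

Section paths.
Context (R : realType) (T : Type) (U : int -> T -> R) (t : T).

Lemma waiting_ge0 i : 0 <= waiting U i t.
Proof. by case: i => [//|i] /=; rewrite le_max lexx. Qed.

(** At time 0 the chain started at -m is at least 0, and the common update max(0, x + u) is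
    nondecreasing in x. *)
Lemma waiting_le_from m i : waiting U i t <= waiting_from U m i t.
Proof.
elim: i => [|i IH]; rewrite /waiting_from.
  by case: (0 + m)%N => [//|k] /=; rewrite le_max lexx.
rewrite addSn /= (_ : (i + m)%:Z - m%:Z = i%:Z); last by rewrite PoszD addrK.
by rewrite ge_max !le_max lexx /= lerD2r IH orbT.
Qed.

(** The witness j counts the steps since the chain was last at 0. From then on the maximum is never
    attained by 0 alone, so the increments just add up; they are listed backwards in time. *)
Lemma waiting_steps_sum m k : waiting_steps U m k t != 0 ->
  exists2 j, (j <= k)%N &
    waiting_steps U m k t = \sum_(l < j) U (k%:Z - m%:Z - l.+1%:Z) t.
Proof.
elim: k => [|k IH] /=; first by rewrite eqxx.
have shift j : \sum_(l < j) U (k%:Z - m%:Z - l.+1%:Z) t + U (k%:Z - m%:Z) t =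
    \sum_(l < j.+1) U (k.+1%:Z - m%:Z - l.+1%:Z) t.
  rewrite big_ord_recl addrC; congr (U _ t + _); first by rewrite /=; lia.
  by apply: eq_bigr => l _; congr (U _ t); rewrite /= /bump /=; lia.
have [|_ _] := leP (waiting_steps U m k t + U (k%:Z - m%:Z) t) 0.
  by rewrite eqxx.
have [->|/IH[j jk ->]] := eqVneq (waiting_steps U m k t) 0.
  by exists 1%N => //; rewrite -shift big_ord0.
by exists j.+1 => //; rewrite shift.
Qed.

Lemma waiting_from_neq m i : waiting_from U m i t != waiting U i t ->
  exists2 k, (k <= m)%N &
    0 < \sum_(l < i + k) U (i%:Z - l.+1%:Z) t.
Proof.
move=> ne.
(* Positivity of the sum is not inductive, so the induction carries the exact value of the upper
   chain. Positivity then follows because that chain lies strictly above a nonnegative one. *)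
suff [k km E] : exists2 k, (k <= m)%N &
    waiting_from U m i t = \sum_(l < i + k) U (i%:Z - l.+1%:Z) t.
  exists k => //; rewrite -E (le_lt_trans (waiting_ge0 i))//.
  by rewrite lt_neqAle eq_sym ne waiting_le_from.
elim: i ne => [|i IH].
  rewrite {1}/waiting_from /= => /waiting_steps_sum[j jm E].
  exists j => //; rewrite /waiting_from E; apply: eq_bigr => l _.
  by rewrite add0n subrr.
rewrite /waiting_from addSn /= (_ : (i + m)%:Z - m%:Z = i%:Z); last lia.
have := waiting_le_from m i; rewrite /waiting_from => le.
case: (eqVneq (waiting_from U m i t) (waiting U i t)) => [|/IH[k km E]].
  by rewrite /waiting_from => ->; rewrite eqxx.
rewrite /waiting_from in E.
(* A reset of the upper chain also resets the lower one, so the chains would agree at time i + 1. *)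
have [W0|_] := leP (waiting_steps U m (i + m) t + U i%:Z t) 0.
  by rewrite (max_idPl (le_trans _ W0)) ?eqxx// lerD2r.
move=> _; exists k => //; rewrite E addrC big_ord_recl.
congr (U _ t + _); first by rewrite /=; lia.
Qed.

End paths.

(** * Powers, centering and constants; the sixth moment bound for partial sums *)

Section moments.
Context d (T : measurableType d) (R : realType) (P : probability T R).
Implicit Types (X Z : {mfun T >-> R}) (Y : nat -> {mfun T >-> R}).

Lemma mfunXE X n t : (X ^+ n) t = X t ^+ n.
Proof. by rewrite mfunX. Qed.

(** Domination by 1 + X^n: the first term serves where |X| <= 1, the second elsewhere. Evenness of n
    makes X^n equal to |X|^n. *)
Lemma sintegrableX X n a : (a <= n)%N -> ~~ odd n ->
  sintegrable P (X ^+ n) -> sintegrable P (X ^+ a).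
Proof.
move=> an on iX.
have : sintegrable P (1 + X ^+ n).
  by apply: sintegrableD => //; exact: sintegrable1.
apply: le_integrable => //; first exact/measurable_EFinP.
move=> t _.
have -> : (EFin \o (1 + X ^+ n : {mfun T >-> R})) t = (1 + X t ^+ n)%:E.
  by have <- : (X ^+ n) t = X t ^+ n by rewrite mfunX.
rewrite /= lee_fin mfunX normrX.
have Xn : X t ^+ n = `|X t| ^+ n by rewrite -normrX ger0_norm ?exprn_even_ge0.
have -> : `|1 + X t ^+ n| = 1 + `|X t| ^+ n.
  by rewrite Xn ger0_norm// addr_ge0// exprn_ge0.
have [x1|x1] := leP `|X t| 1.
  apply: le_trans (exprn_ile1 _ _ x1) _; rewrite ?normr_ge0//.
  by rewrite lerDl exprn_ge0.
by apply: le_trans (ler_weXn2l (ltW x1) an) _; rewrite lerDr.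
Qed.

(** Lets scaling and centering reuse the product and binomial rules for independent pairs. *)
Lemma independent_pair_cst X (r : R) : independent_pair P X (cst r).
Proof.
move=> A B mA mB; have [rB|rB] := pselect (B r).
  have -> : cst r @^-1` B = [set: T] by apply/seteqP; split.
  by rewrite setIT probability_setT mule1.
have -> : cst r @^-1` B = set0 :> set T by apply/seteqP; split.
by rewrite setI0 measure0 mule0.
Qed.

Lemma sintegrable_cst (r : R) : sintegrable P (cst r).
Proof. exact: finite_measure_integrable_cst. Qed.

Lemma mean_cst (r : R) : mean P (cst r) = r.
Proof.
have -> : mean P (cst r) = \int[P]_(t in setT) r by [].
rewrite Rintegral_cst//.
by rewrite [fine _](congr1 fine (probability_setT P)) mulr1.
Qed.

Lemma meanMcst X (r : R) : sintegrable P X -> mean P (X * cst r) = mean P X * r.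
Proof.
move=> iX; rewrite meanM ?mean_cst//; first exact: independent_pair_cst.
exact: sintegrable_cst.
Qed.

Lemma sintegrableMcst X (r : R) : sintegrable P X -> sintegrable P (X * cst r).
Proof.
move=> iX; apply: sintegrableM => //; first exact: independent_pair_cst.
exact: sintegrable_cst.
Qed.

Lemma cst_mfunX (r : R) k : (cst r : {mfun T >-> R}) ^+ k = cst (r ^+ k).
Proof. by apply/mfuneqP => t; rewrite mfunX. Qed.

Lemma sintegrable_centeredX X (r : R) n : ~~ odd n ->
  sintegrable P (X ^+ n) ->
  forall a, (a <= n)%N -> sintegrable P ((X - cst r) ^+ a).
Proof.
move=> on iX a an.
have -> : X - cst r = X + cst (- r) by apply/mfuneqP.
apply: (proj1 (meanXD (independent_pair_cst _ _) _ _)) => b ba.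
  by apply: sintegrableX iX => //; exact: leq_trans an.
by rewrite cst_mfunX; exact: sintegrable_cst.
Qed.

Lemma mean_ge0 X : (forall t, 0 <= X t) -> 0 <= mean P X.
Proof. by move=> X0; apply: Rintegral_ge0 => t _; exact: X0. Qed.

Lemma mean_eq_law X Z (g : R -> R) : measurable_fun setT g ->
  (forall B : set R, measurable B -> P (X @^-1` B) = P (Z @^-1` B)) ->
  P.-integrable setT (EFin \o (g \o X)) ->
  P.-integrable setT (EFin \o (g \o Z)) ->
  \int[P]_t g (X t) = \int[P]_t g (Z t).
Proof.
move=> mg XZ iX iZ; rewrite /Rintegral; congr fine.
have mEg : measurable_fun setT (EFin \o g) by exact/measurable_EFinP.
rewrite -(integral_distribution (X := X) mEg iX).
rewrite -(integral_distribution (X := Z) mEg iZ).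
by apply: eq_measure_integral => A mA _; exact: XZ.
Qed.

Lemma sixth_moment_partial_sum Y (A : nat -> R) n :
  mutually_independent P (fun l => Y l : T -> R) ->
  (forall l a, (a <= 6)%N -> sintegrable P (Y l ^+ a)) ->
  (forall l a, (a <= 6)%N -> mean P (Y l ^+ a) = A a) ->
  A 1%N = 0 ->
  sintegrable P ((\sum_(l < n) Y l) ^+ 6) /\
  mean P ((\sum_(l < n) Y l) ^+ 6) <= sixth_moment_const A * n%:R ^+ 3.
Proof.
move=> indY iY EY A1.
have iS k a : (a <= 6)%N -> sintegrable P ((\sum_(l < k) Y l) ^+ a).
  elim: k a => [|k IH] a a6.
    rewrite big_ord0 expr0n; case: eqP => _; first exact: sintegrable1.
    exact: sintegrable0.
  rewrite big_ord_recr /=; apply: (proj1 (meanXD _ _ _)) => [|b ba|b ba].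
  - exact: partial_sum_independent_next.
  - by apply: IH; exact: leq_trans a6.
  - by apply: iY; exact: leq_trans a6.
split; first exact: iS.
have even_ge0 a : (a <= 6)%N -> ~~ odd a -> 0 <= A a.
  move=> a6 oa; rewrite -(EY 0%N)//; apply: mean_ge0 => t.
  by rewrite mfunX exprn_even_ge0.
apply: (sixth_moment_growth (m := fun k a => mean P ((\sum_(l < k) Y l) ^+ a))
  (A := A)) => //; try exact: even_ge0.
- by rewrite -(EY 0%N)// expr0 mean1.
- by move=> k; rewrite expr0 mean1.
- by move=> k; rewrite big_ord0 expr0n mean0.
- move=> k a a6; rewrite big_ord_recr /= (proj2 (meanXD _ _ _)).
  + apply: eq_bigr => i _; rewrite EY//.
    by apply: leq_trans a6; rewrite -ltnS.
  + exact: partial_sum_independent_next.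
  + by move=> b ba; apply: iS; exact: leq_trans a6.
  + by move=> b ba; apply: iY; exact: leq_trans a6.
Qed.

(** Links the extended-real expectation to the real-valued [mean] in which the moments are
    computed. *)
Lemma expectation_le_mean (g : T -> R) X : measurable_fun setT g ->
  (forall t, 0 <= g t) -> (forall t, g t <= X t) -> sintegrable P X ->
  ('E_P[g] <= (mean P X)%:E)%E.
Proof.
move=> mg g0 gX iX; rewrite unlock /mean /Rintegral fineK; last first.
  exact: integrable_fin_num.
apply: ge0_le_integral => //.
- by move=> t _; rewrite lee_fin.
- exact/measurable_EFinP.
- exact/measurable_EFinP.
- by move=> t _; rewrite lee_fin.
Qed.

Lemma measurable_waiting_steps (U : int -> {mfun T >-> R}) m k :
  measurable_fun setT (waiting_steps (fun j => U j) m k).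
Proof.
elim: k => [|k IH] /=; first exact: measurable_cst.
by apply: measurable_maxr => //; apply: measurable_funD.
Qed.

Lemma measurable_waiting (U : int -> {mfun T >-> R}) i :
  measurable_fun setT (waiting (fun j => U j) i).
Proof.
elim: i => [|i IH] /=; first exact: measurable_cst.
by apply: measurable_maxr => //; apply: measurable_funD.
Qed.

End moments.

(** * Increments read backwards from time i, convergence of the series, and the final estimate *)

Lemma centered_reindex_independent d (T : measurableType d) (R : realType)
    (P : probability T R) (U : int -> {mfun T >-> R}) (r : R) (i : nat) :
  mutually_independent P (fun j => U j : T -> R) ->
  mutually_independent P
    (fun l : nat => (U (i%:Z - l.+1%:Z) - cst r : {mfun T >-> R}) : T -> R).
Proof.
move=> indU J B uJ mB.
(* The absolute value inverts l |-> i - (l + 1) on its image; its values at other j never enter the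
   product over J. *)
pose B' (j : int) := (fun x : R => x - r) @^-1` B `|(i%:Z - 1 - j)%R|%N.
have mB' j : measurable (B' j).
  rewrite /B' -[_ @^-1` _]setTI.
  have mr : measurable_fun setT (fun x : R => x - r) by exact: measurable_funB.
  exact: mr.
have uJ' : uniq [seq (i%:Z - l.+1%:Z : int) | l <- J].
  by rewrite map_inj_uniq// => k l; lia.
have pre l : U (i%:Z - l.+1%:Z) @^-1` B' (i%:Z - l.+1%:Z) =
    (U (i%:Z - l.+1%:Z) - cst r : {mfun T >-> R}) @^-1` B l.
  by rewrite /B' (_ : absz _ = l)//; lia.
have := indU _ B' uJ' mB'; rewrite !big_map.
by under eq_bigr do rewrite pre; under [RHS]eq_bigr do rewrite pre.
Qed.

Lemma sum_sqrt_inv_cube_lty (R : realType) (c : R) : 0 <= c ->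
  (\sum_(0 <= i <oo) (Num.sqrt (c * i.+1%:R ^- 2 / i.+1%:R)%R)%:E < +oo)%E.
Proof.
move=> c0.
apply: (@le_lt_trans _ _ (3 * Num.sqrt c)%:E); last exact: ltry.
apply: lime_le.
  by apply: is_cvg_nneseries => n _ _; rewrite lee_fin sqrtr_ge0.
apply: nearW => n; rewrite sumEFin lee_fin.
(* Each term is sqrt(c) (i+1)^(-3/2), so the partial sums stay below 3 sqrt(c). *)
have sqrtE i : Num.sqrt (c * i.+1%:R ^- 2 / i.+1%:R) =
    Num.sqrt c * Num.sqrt (i.+1%:R^-1) ^+ 3 :> R.
  rewrite -mulrA sqrtrM//; congr (_ * _).
  rewrite -exprVn -exprSr exprS sqrtrM ?invr_ge0//.
  by rewrite sqrtr_sqr ger0_norm ?invr_ge0// exprS sqr_sqrtr ?invr_ge0.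
under eq_bigr do rewrite sqrtE.
rewrite -mulr_sumr mulrC ler_wpM2r ?sqrtr_ge0//.
case: n => [|n]; first by rewrite big_geq.
apply: le_trans (sum_sqrt_inv_cube_le R n) _.
by rewrite gerBl mulr_ge0// sqrtr_ge0.
Qed.

Theorem proposition4p2 (d : measure_display) (T : measurableType d)
    (R : realType) (P : probability T R)
    (D V : nat -> {RV P >-> R}) (U : int -> {RV P >-> R}) (z : R)
    (hDV : GI_G_1 D V)
    (hU : forall (n : nat) (t : T), U n%:Z t = V n t - D n t)
    (hiid : iid U)
    (hneg : forall i : int, ('E_P[U i] < 0)%E)
    (hmom : forall i : int, ('E_P[fun t => (U i t ^+ 6)%R] < +oo)%E) :
  let f : R -> R := \1_[set u | z < u] in
  let X (m i : nat) : T -> R := waiting_from (fun j => U j) m i in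
  let X0 (i : nat) : T -> R := waiting (fun j => U j) i in
  exists2 c : R, 0 < c &
    let nu (i : nat) : R := c * i.+1%:R ^- 2 in
    [/\ forall i m : nat,
          ('E_P[fun t => ((f (X m i t) - f (X0 i t)) ^+ 2)%R] <= (nu i)%:E)%E,
        forall i : nat, 0 < nu i,
        forall i : nat, nu i.+1 < nu i &
        (\sum_(0 <= i <oo) (Num.sqrt (nu i / i.+1%:R)%R)%:E < +oo)%E].
Proof.
move=> f X X0.
pose W (j : int) : {mfun T >-> R} := U j.
have [lawU indU] := hiid.
have iW6 j : sintegrable P (W j ^+ 6).
  apply/integrableP; split; first exact/measurable_EFinP.
  have := hmom j; rewrite unlock; apply: le_lt_trans.
  rewrite le_eqVlt; apply/orP; left; apply/eqP; apply: eq_integral => t _.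
  have -> : (EFin \o (W j ^+ 6)) t = (W j t ^+ 6)%:E by rewrite -mfunXE.
  by rewrite gee0_abs// lee_fin exprn_even_ge0.
have iW j : sintegrable P (W j).
  by have := sintegrableX (isT : (1 <= 6)%N) isT (iW6 j).
pose mu := mean P (W 0).
have mu0 : mu < 0.
  have := hneg 0; rewrite unlock -[X in (X < _)%E]fineK ?lte_fin//.
  exact: (integrable_fin_num _ (iW 0)).
have law j (B : set R) : measurable B -> P (W j @^-1` B) = P (W 0 @^-1` B).
  exact: lawU.
pose Y j : {mfun T >-> R} := W j - cst mu.
have iY j a : (a <= 6)%N -> sintegrable P (Y j ^+ a).
  by move=> a6; exact: (sintegrable_centeredX _ _ (iW6 j)).
pose A a := mean P (Y 0 ^+ a).
have EY j a : (a <= 6)%N -> mean P (Y j ^+ a) = A a.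
  move=> a6; rewrite /A /mean !mfunX.
  apply: (@mean_eq_law _ _ _ _ (W j) (W 0) (fun x => (x - mu) ^+ a)).
  - by apply: measurable_funX; exact: measurable_funB.
  - exact: law.
  - by have := iY j a a6; rewrite /sintegrable mfunX.
  - by have := iY 0 a a6; rewrite /sintegrable mfunX.
have A1 : A 1%N = 0.
  have -> : A 1%N = mean P (W 0 + cst (- mu)).
    by rewrite /A expr1; congr mean; apply/mfuneqP.
  by rewrite meanD//; [rewrite mean_cst subrr|exact: sintegrable_cst].
(* The centered increments at the n times i-1, ..., i-n, matching the sums in [waiting_from_neq]. *)
pose S i n : {mfun T >-> R} := \sum_(l < n) Y (i%:Z - l.+1%:Z).
have S6 i n : sintegrable P (S i n ^+ 6) /\
    mean P (S i n ^+ 6) <= sixth_moment_const A * n%:R ^+ 3.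
  have indY := centered_reindex_independent mu i indU.
  exact: (sixth_moment_partial_sum n indY (fun l => iY _) (fun l => EY _) A1).
set K := sixth_moment_const A in S6.
(* K is nonnegative because it bounds a sixth moment, that of a single centered increment. *)
have K0 : 0 <= K.
  have [_] := S6 0%N 1%N; rewrite expr1n mulr1; apply: le_trans.
  by apply: mean_ge0 => t; rewrite mfunXE exprn_even_ge0.
have mu6 : 0 < mu ^+ 6 by rewrite exprn_even_gt0//= lt_eqF.
(* K / mu^6 comes from Markov's inequality and 32 from [sum_inv_cube_le]. The summand 1 makes c
   positive and covers i = 0, where only the trivial bound by 1 is used. *)
pose c := 1 + 32 * K / mu ^+ 6.
have Kmu : 0 <= K / mu ^+ 6 by rewrite divr_ge0// ltW.
have c0 : 0 < c by rewrite /c -mulrA; move: Kmu; lra.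
have fX m i t : (f (X m i t) - f (X0 i t)) ^+ 2 <= 1.
  rewrite /f !indicE; do 2 case: (_ \in _) => /=;
    by rewrite ?subrr ?subr0 ?sub0r ?sqrrN ?expr0n ?expr1n.
have mf : measurable_fun setT f.
  apply: measurable_indic; rewrite (_ : [set u | _] = [set` `]z, +oo[])//.
  by apply/seteqP; split => x /=; rewrite in_itv/= andbT.
have mfX m i : measurable_fun setT (fun t => (f (X m i t) - f (X0 i t)) ^+ 2).
  apply: measurable_funX; apply: measurable_funB.
    by apply: measurableT_comp => //; exact: (measurable_waiting_steps W).
  by apply: measurableT_comp => //; exact: (measurable_waiting W).
have scale (u x : R) : u != 0 -> x != 0 ->
    K * x ^+ 3 * (x * - u) ^- 6 = K / u ^+ 6 * x ^- 3.
  by move=> u0 x0; field; rewrite ?oppr_eq0 u0 x0.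
exists c => // nu; split.
- move=> [|i] m.
    have g0 t : 0 <= (f (X m 0%N t) - f (X0 0%N t)) ^+ 2 by exact: sqr_ge0.
    have g1 t : (f (X m 0%N t) - f (X0 0%N t)) ^+ 2 <= (1 : {mfun T >-> R}) t.
      exact: fX.
    apply: le_trans (expectation_le_mean (mfX m 0%N) g0 g1 (sintegrable1 P)) _.
    by rewrite mean1 lee_fin /nu expr1n invr1 mulr1 /c -mulrA; move: Kmu; lra.
  (* Markov's inequality in pointwise form: with n = i + 1 + k, the variable (S_n / (n |mu|))^6 is
     nonnegative, and at least 1 where the n uncentered increments have a positive sum. Summing over
     k <= m dominates the squared difference. *)
  pose H (k : nat) : {mfun T >-> R} :=
    S i.+1 (i.+1 + k)%N ^+ 6 * cst (((i.+1 + k)%:R * - mu) ^- 6).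
  have HE k t : H k t =
      S i.+1 (i.+1 + k)%N t ^+ 6 * ((i.+1 + k)%:R * - mu) ^- 6.
    by rewrite -mfunXE.
  have iH k : sintegrable P (H k) by apply: sintegrableMcst; exact: (S6 _ _).1.
  have [iHs EHs] := mean_sum (index_enum 'I_m.+1) (fun k : 'I_m.+1 => iH k).
  apply: le_trans (expectation_le_mean (mfX m i.+1) _ _ iHs) _.
  + by move=> t; exact: sqr_ge0.
  + move=> t; rewrite mfun_sum.
    have H0 (k : nat) : 0 <= H k t.
      by rewrite HE mulr_ge0 ?invr_ge0 ?exprn_even_ge0.
    have [E|/(@waiting_from_neq R T (fun j => U j))[k km Spos]] :=
      eqVneq (X m i.+1 t) (X0 i.+1 t).
      by rewrite E subrr expr0n sumr_ge0.
    apply: le_trans (fX _ _ _) _.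
    have km1 : (k < m.+1)%N by [].
    (* The term of the k found on this path already reaches 1; the others are nonnegative. *)
    rewrite (bigD1 (Ordinal km1))// -[leLHS]addr0 lerD ?sumr_ge0//.
    rewrite (HE k) -exprVn -exprMn exprn_ege1//.
    have n0 : 0 < (i.+1 + k)%:R * - mu by rewrite mulr_gt0 ?oppr_gt0.
    rewrite ler_pdivlMr// mul1r /S mfun_sum.
    (* Undoing the centering: S_n is the positive uncentered sum plus n |mu|, hence exceeds n
       |mu|. *)
    rewrite [leRHS](_ : _ = \sum_(l < i.+1 + k) U (i.+1%:Z - l.+1%:Z) t +
      (i.+1 + k)%:R * - mu); first by rewrite lerDr ltW.
    by rewrite big_split /= sumr_const card_ord mulr_natl.
  + rewrite EHs lee_fin.
    (* Each term has mean at most K n^3 / (n |mu|)^6 = (K / mu^6) n^(-3). *)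
    apply: (@le_trans _ _ (\sum_(k < m.+1) K / mu ^+ 6 * (i.+1 + k)%:R ^- 3)).
      apply: ler_sum => k _; rewrite /H meanMcst; last exact: (S6 _ _).1.
      have [_ Sk] := S6 i.+1 (i.+1 + k)%N.
      have n0 : 0 < (i.+1 + k)%:R :> R by rewrite ltr0n.
      apply: le_trans (ler_wpM2r _ Sk) _.
        by rewrite invr_ge0 exprn_even_ge0.
      rewrite le_eqVlt; apply/orP; left; apply/eqP.
      by apply: scale; [rewrite lt_eqF|rewrite gt_eqF].
    rewrite -mulr_sumr.
    apply: le_trans (ler_wpM2l Kmu (sum_inv_cube_le _ _ _)) _ => //.
    rewrite mulrA /nu ler_wpM2r ?invr_ge0 ?exprn_ge0// /c -mulrA.
    by move: Kmu; lra.
- by move=> i; rewrite /nu mulr_gt0// invr_gt0 exprn_gt0.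
- move=> i; rewrite /nu ltr_pM2l// ltf_pV2 ?posrE ?exprn_gt0//.
  by rewrite ltrXn2r// ltr_nat.
- exact: sum_sqrt_inv_cube_lty (ltW c0).
Qed.
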